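(* $$\sum_{\pi\in\mathcal{G}_N^{O}}q^{|\pi|}=(-q;q)_\infty^2 .$$
   Context: An overpartition is a finite non-increasing sequence of positive integers (its parts) in which the first occurrence of each number may be overlined (so for each size $t$ at most one part of size $t$ is overlined); the size of a part $t$ or $\overline{t}$ is $t$, and the weight $|\pi|$ is the sum of the sizes of the parts. The empty overpartition has weight $0$. $\mathcal{G}_N^{O}$ is the set of overpartitions (including the empty one) such that the sizes of overlined parts (if any exist) are greater than the sizes of all non-overlined parts. Here $|q|<1$ (or $q$ is a formal variable), $(a;q)_\infty=\prod_{i=0}^{\infty}(1-aq^i)$. *)

(* Defs.v *)
From HB Require Import structures.
From mathcomp Require Import all_boot all_order all_algebra finmap.
From mathcomp Require Import all_classical all_reals all_analysis.
From mathcomp Require Import complex.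
(* Required without Import: its [sum] and [summable] would shadow other names. *)
From mathcomp Require summability.

Set Implicit Arguments.
Unset Strict Implicit.
Unset Printing Implicit Defensive.

Import Order.TTheory GRing.Theory Num.Theory.
Import numFieldNormedType.Exports.

Local Open Scope ring_scope.
Local Open Scope classical_set_scope.

(* The part t is (t, false) and the overlined part \overline{t} is (t, true). *)
Definition part : Type := (nat * bool)%type.
Definition psize (p : part) : nat := p.1.
Definition overlined (p : part) : bool := p.2.

(* [pairwise r s] quantifies over all positions i < j of s, so the last
   conjunct says that a part preceded by a part of the same size is not
   overlined: only the first occurrence of each size may be. *)
Definition is_overpartition (s : seq part) : bool :=
  [&& all (fun p => (0 < psize p)%N) s,
      sorted geq (map psize s)
    & pairwise (fun p p' => (psize p' == psize p) ==> ~~ overlined p') s].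

Definition overpartition := {s : seq part | is_overpartition s}.
HB.instance Definition _ := Choice.on overpartition.

Definition parts (lam : overpartition) : seq part := val lam.

Definition weight (lam : overpartition) : nat :=
  (\sum_(p <- parts lam) psize p)%N.

Definition GNO : pred overpartition := fun lam =>
  all (fun p => all (fun p' =>
    overlined p && ~~ overlined p' ==> (psize p' < psize p)%N)
    (parts lam)) (parts lam).

Definition qpoch (K : numFieldType) (a q : K) (n : nat) : K :=
  \prod_(0 <= i < n) (1 - a * q ^+ i).

Definition qpoch_inf (K : numFieldType) (a q : K) : K := limn (qpoch a q).

(* Unordered sums: limit of the finite partial sums along the directed set of
   finite subsets of the index type. *)
Definition sum_converges (K : numFieldType) (I : choiceType) (f : I -> K) :
  Prop := cvg (summability.partial_sum f @ summability.totally).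

Definition unordered_sum (K : numFieldType) (I : choiceType) (f : I -> K) : K :=
  summability.sum (f : I -> K^o).

(* Main.v *)
Require Import Defs.
From mathcomp Require Import all_boot all_order all_algebra finmap.
From mathcomp Require Import all_classical all_reals all_analysis.
From mathcomp Require Import complex.
From mathcomp Require Import zify ring lra.

Set Implicit Arguments.
Unset Strict Implicit.
Unset Printing Implicit Defensive.

Import Order.TTheory GRing.Theory Num.Theory.
Import numFieldNormedType.Exports.

Local Open Scope ring_scope.
Local Open Scope classical_set_scope.

(* Let G_n and P_n be the generating functions of the GNO overpartitions, resp.
   ordinary partitions, with parts of size at most n.  Looking at the largest part,
     G_(n+1) = (1 + q^(n+1)) G_n + q^(n+1) P_(n+1),   P_n = 1 / (q; q)_n,
   so T_n := (q; q)_n G_n is a polynomial with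
   T_(n+1) = (1 - q^(2n+2)) T_n + q^(n+1), the truncated Cauchy sum
   (q^2; q^2)_n \sum_(k <= n) q^k / (q^2; q^2)_k.  Its q-difference equation gives
   (q; q^2)_n T_n = (q^2; q^2)_n mod q^(n+1); since (q; q^2)_n (-q; q)_n = 1
   mod q^(n+1), it follows that G_n = (-q; q)_n^2 mod q^(n+1).  Hence the n-th
   coefficient c_n of the left-hand side is that of (-q; q)_N^2 for all N >= n.
   For 0 <= r < 1 each (-r; r)_n^2 then lies between partial sums of
   \sum c_m r^m; with r = |q| this bounds all the error terms. *)

(** * Enumeration by weight *)

Definition gno_seq (s : seq part) : bool :=
  all (fun p => all (fun p' =>
    overlined p && ~~ overlined p' ==> (psize p' < psize p)%N) s) s.

Definition weight_seq (s : seq part) : nat := (\sum_(p <- s) psize p)%N.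

(* With b = false no part may be overlined.  Since all the overlined parts of a
   GNO overpartition precede the others, the flag is all the memory needed to
   read such a list from left to right. *)
Fixpoint gno_from (b : bool) (n : nat) (s : seq part) : bool :=
  if s is (t, o) :: s' then
    [&& (0 < t)%N, (t <= n)%N
      & if o then b && gno_from true t.-1 s' else gno_from false t s']
  else true.

Lemma is_overpartition_cons (p : part) (s : seq part) :
  is_overpartition (p :: s) =
  [&& (0 < psize p)%N, all (fun p' => (psize p' <= psize p)%N) s,
      all (fun p' => (psize p' == psize p) ==> ~~ overlined p') s
    & is_overpartition s].
Proof.
rewrite /is_overpartition /= path_sortedE; last first.
  by move=> x y z /= h1 h2; apply: leq_trans h2 h1.
rewrite all_map; apply/idP/idP.
  by move=> /and3P[/andP[-> ->] /andP[-> ->] /andP[-> ->]].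
by move=> /and4P[-> -> -> /and3P[-> -> ->]].
Qed.

Lemma gno_seq_cons (p : part) (s : seq part) :
  gno_seq (p :: s) =
  [&& all (fun p' => overlined p && ~~ overlined p' ==>
        (psize p' < psize p)%N) s,
      all (fun p' => overlined p' && ~~ overlined p ==>
        (psize p < psize p')%N) s
    & gno_seq s].
Proof. by rewrite /gno_seq /= all_predI andbN. Qed.

(** After an overlined head of size t every later part is smaller than t: an overlined one because
    only the first occurrence of a size may be overlined, a plain one by the condition on GNO. Hence
    the new bound [t.-1]. After a plain head an overlined part would have to be larger, against the
    order, so the flag drops to [false]. *)
Lemma gno_fromE (b : bool) (n : nat) (s : seq part) :
  gno_from b n s =
  [&& is_overpartition s, all (fun p => (psize p <= n)%N) s, gno_seq s
    & b || all (fun p => ~~ overlined p) s].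
Proof.
elim: s b n => [|[t o] s IH] b n; first by rewrite /= orbT.
rewrite is_overpartition_cons gno_seq_cons /=.
case: (posnP t) => [->|t_gt0] //=; case: leqP => tn /=; last by rewrite andbF.
case: o => /=.
- case: b => /=; last by rewrite !andbF.
  rewrite IH /= !andbT; apply/idP/idP.
  + move=> /and3P[-> /allP sle ->]; rewrite /= !andbT.
    rewrite -!andbA; apply/and5P; split; apply/allP => p /[dup] ps /sle;
      rewrite /psize /= => h.
    * by lia.
    * by apply/implyP => /eqP; lia.
    * by lia.
    * by apply/implyP => _; lia.
    * by rewrite andbF.
  + move=> /andP[/and3P[/allP sle /allP sov ->]].
    move=> /andP[_ /and3P[/allP gs _ ->]]; rewrite /= andbT.
    apply/allP => p ps; move: (sle _ ps) (sov _ ps) (gs _ ps).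
    rewrite /psize; case: (overlined p) => /=; lia.
- rewrite IH /=; apply/idP/idP.
  + move=> /and4P[-> /[dup] sle0 /allP sle -> /[dup] sov0 /allP sov].
    rewrite sov0 sle0 orbT /= !andbT.
    apply/and4P; split; apply/allP => p /[dup] ps /sle; rewrite /psize /= => h.
    * by rewrite sov // implybT.
    * by lia.
    * by [].
    * by rewrite andbT (negbTE (sov _ ps)).
  + move=> /andP[/and3P[/[dup] sle0 /allP sle _ ->]].
    move=> /andP[_ /andP[/and3P[_ /allP gs ->] _]]; rewrite sle0 /=.
    apply/allP => p ps; move: (sle _ ps) (gs _ ps).
    rewrite /psize; case: (overlined p) => //=; lia.
Qed.

Lemma gno_fromT (n : nat) (s : seq part) :
  gno_from true n s =
  [&& is_overpartition s, gno_seq s & all (fun p => (psize p <= n)%N) s].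
Proof. by rewrite gno_fromE andbT [X in _ && X]andbC. Qed.

Lemma all_le_weight_seq (s : seq part) :
  all (fun p => (psize p <= weight_seq s)%N) s.
Proof.
apply/allP => p ps; rewrite /weight_seq (big_rem _ ps) /=; exact: leq_addr.
Qed.

Lemma weight_seq_cons (p : part) (s : seq part) :
  weight_seq (p :: s) = (psize p + weight_seq s)%N.
Proof. by rewrite /weight_seq big_cons. Qed.

(* k is fuel: gno_enum k b n m lists the s of weight m with gno_from b n s as
   soon as n + m < k. *)
Fixpoint gno_enum (k : nat) (b : bool) (n m : nat) : seq (seq part) :=
  if k is k'.+1 then
    if n is n'.+1 then
      gno_enum k' b n' m ++
      if (n <= m)%N then
        (if b then [seq (n, true) :: s | s <- gno_enum k' true n' (m - n)]
         else [::]) ++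
        [seq (n, false) :: s | s <- gno_enum k' false n (m - n)]
      else [::]
    else if m == 0%N then [:: [::]] else [::]
  else [::].

Lemma mem_map_cons (T : eqType) (x y : T) (s : seq T) (L : seq (seq T)) :
  (y :: s \in [seq x :: s' | s' <- L]) = (y == x) && (s \in L).
Proof.
apply/mapP/andP => [[s' s'L [-> ->]]|[/eqP -> sL]]; first by rewrite eqxx.
by exists s.
Qed.

Lemma nil_map_cons (T : eqType) (x : T) (L : seq (seq T)) :
  ([::] \in [seq x :: s' | s' <- L]) = false.
Proof. by apply/negbTE/mapP => -[]. Qed.

(** Each recursive call lowers n + m, so one unit of fuel per call suffices. The branches separate
    the lists with all sizes at most n from those whose head has size n + 1, overlined or not. *)
Lemma mem_gno_enum (k : nat) (b : bool) (n m : nat) (s : seq part) :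
  (n + m < k)%N ->
  (s \in gno_enum k b n m) = gno_from b n s && (weight_seq s == m).
Proof.
elim: k b n m s => [//|k IH] b [|n] m s nmk.
  case: s => [|[t o] s] /=.
    by rewrite /weight_seq big_nil eq_sym; case: eqP.
  by case: t => [|t] //=; case: eqP.
rewrite [gno_enum _ _ _ _]/= mem_cat IH; last by lia.
case: s => [|[t o] s].
  rewrite /weight_seq big_nil; case: (leqP n.+1 m) => _; last by rewrite orbF.
  by rewrite mem_cat nil_map_cons; case: b; rewrite /= ?nil_map_cons !orbF.
rewrite weight_seq_cons /=.
case: (posnP t) => [->|t0] /=.
  case: (leqP n.+1 m) => // _; rewrite mem_cat mem_map_cons.
  by case: b; rewrite ?mem_map_cons.
have -> : (t <= n.+1)%N = (t <= n)%N || (t == n.+1) by lia.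
case: (eqVneq t n.+1) => [->|tn] /=; last first.
  rewrite orbF; case: (leqP n.+1 m) => [_|]; last by rewrite orbF.
  rewrite mem_cat mem_map_cons xpair_eqE (negbTE tn) /= orbF.
  by case: b; rewrite ?mem_map_cons ?xpair_eqE ?(negbTE tn) /= orbF.
rewrite orbT ltnn /=; case: (leqP n.+1 m) => [nm|mn]; last first.
  by rewrite in_nil; apply/esym/negbTE; apply/nandP; right; rewrite /psize /=; lia.
rewrite mem_cat mem_map_cons xpair_eqE eqxx /= IH; last by lia.
have -> : (weight_seq s == m - n.+1)%N = (n.+1 + weight_seq s == m)%N by lia.
case: b; rewrite ?mem_map_cons ?xpair_eqE ?eqxx /=; last by case: o.
rewrite IH; last by lia.
have -> : (weight_seq s == m - n.+1)%N = (n.+1 + weight_seq s == m)%N by lia.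
by case: o; rewrite /= ?orbF.
Qed.

Lemma gno_enum_uniq (k : nat) (b : bool) (n m : nat) :
  (n + m < k)%N -> uniq (gno_enum k b n m).
Proof.
elim: k b n m => [//|k IH] b [|n] m nmk /=; first by case: eqP.
rewrite cat_uniq IH /=; last by lia.
case: (leqP n.+1 m) => // nm.
have cons_uniq x : injective (cons x : seq part -> seq part) by move=> s s' [].
rewrite cat_uniq (map_inj_uniq (cons_uniq _)) (IH false) ?andbT; last by lia.
apply/andP; split.
  apply/hasPn => s; apply: contraL; rewrite mem_gno_enum; last by lia.
  case: s => [|[t o] s] /=.
    by rewrite mem_cat; case: b; rewrite !nil_map_cons.
  case/andP=> /and3P[_ tn _] _.
  rewrite mem_cat mem_map_cons xpair_eqE.
  have /negbTE-> : t != n.+1 by lia.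
  by case: b; rewrite //= mem_map_cons xpair_eqE; lia.
case: b => //=; last by apply/hasPn.
rewrite (map_inj_uniq (cons_uniq _)) IH; last by lia.
apply/hasPn => s /mapP[s' _ ->].
by rewrite /= mem_map_cons xpair_eqE andbF.
Qed.

(** * Counting the lists: recursion and stabilization *)

Definition gno_count (b : bool) (n m : nat) : nat :=
  size (gno_enum (n + m).+1 b n m).

Lemma gno_countP (b : bool) (n m k : nat) :
  (n + m < k)%N -> size (gno_enum k b n m) = gno_count b n m.
Proof.
move=> nmk; apply/perm_size/uniq_perm; rewrite ?gno_enum_uniq// => s.
by rewrite !mem_gno_enum.
Qed.

Lemma gno_count0 (b : bool) (m : nat) : gno_count b 0 m = (m == 0)%N.
Proof. by rewrite /gno_count /=; case: eqP. Qed.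

(** The coefficient form of the recursions for G_n ([b = true]) and P_n ([b = false]). The factor
    [(n < m)] removes the case in which [m - n.+1] is truncated to 0. *)
Lemma gno_countS (b : bool) (n m : nat) :
  gno_count b n.+1 m = (gno_count b n m + (n < m) *
    (b * gno_count true n (m - n.+1) + gno_count false n.+1 (m - n.+1)))%N.
Proof.
set c := gno_count b n m; rewrite {1}/gno_count.
(* One unfolding of the enumeration; the remaining fuel [(n + m).+1] still suffices for all three
   calls. *)
change (size (gno_enum (n + m).+1 b n m ++
  if (n < m)%N then
    (if b then [seq (n.+1, true) :: s | s <- gno_enum (n + m).+1 true n (m - n.+1)]
     else [::]) ++
    [seq (n.+1, false) :: s | s <- gno_enum (n + m).+1 false n.+1 (m - n.+1)]
  else [::]) = (c + (n < m) *
    (b * gno_count true n (m - n.+1) + gno_count false n.+1 (m - n.+1)))%N).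
rewrite size_cat.
rewrite !gno_countP//; congr addn; case: (leqP n.+1 m) => nm; last by [].
rewrite mul1n size_cat !size_map gno_countP; last by lia.
congr addn; case: {c}b => //; rewrite size_map gno_countP ?mul1n//; lia.
Qed.

(** No part exceeds the weight m, so a size bound beyond m has no effect. The common value is the
    coefficient c_m. *)
Lemma gno_count_le (n m : nat) : (m <= n)%N ->
  gno_count true n m = gno_count true m m.
Proof.
move=> mn; apply/perm_size/uniq_perm; rewrite ?gno_enum_uniq// => s.
rewrite !mem_gno_enum// !gno_fromT.
case: eqP => [wm|]; last by rewrite !andbF.
have /allP h := all_le_weight_seq s; rewrite wm in h.
have -> : all (fun p => (psize p <= n)%N) s.
  by apply/allP => p /h /leq_trans; apply.
by have /allP -> := h.
Qed.

(** * The generating function modulo a power of the variable *)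

Section TruncatedIdentity.
Variable F : fieldType.
Implicit Types (p r : {poly F}) (n m M : nat).

(* (Q; Q)_n \sum_(k <= n) z^k / (Q; Q)_k, cleared of denominators. *)
Fixpoint cauchy_sum (A : comNzRingType) (Q z : A) (n : nat) : A :=
  if n is n'.+1 then (1 - Q ^+ n) * cauchy_sum Q z n' + z ^+ n else 1.

(** The series F(z) = \sum_k z^k / (Q; Q)_k satisfies F(z) - F(Q z) = z F(z); cutting it off after k
    = n leaves the single boundary term z^(n+1). *)
Lemma cauchy_sumE (A : comNzRingType) (Q z : A) (n : nat) :
  (1 - z) * cauchy_sum Q z n = cauchy_sum Q (Q * z) n - z ^+ n.+1.
Proof.
elim: n => [|n IH] /=; first by rewrite mulr1 expr1.
rewrite mulrDr mulrCA IH exprMn (exprS z n.+1); ring.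
Qed.

(** Modulo z only the summand k = 0 survives. *)
Lemma cauchy_sum_mod (A : comNzRingType) (Q z : A) (n : nat) :
  exists u, cauchy_sum Q z n = \prod_(i < n) (1 - Q ^+ i.+1) + u * z.
Proof.
elim: n => [|n [u IH]] /=; first by exists 0; rewrite big_ord0 mul0r addr0.
exists ((1 - Q ^+ n.+1) * u + z ^+ n).
rewrite big_ord_recr /= IH (exprSr z); ring.
Qed.

(** In this order: (-X; X)_n, (X; X)_n, (X; X^2)_n and the T_n of the overview. *)
Definition dpoly n : {poly F} := \prod_(i < n) (1 + 'X^(i.+1)).
Definition qpoly n : {poly F} := \prod_(i < n) (1 - 'X^(i.+1)).
Definition opoly n : {poly F} := \prod_(i < n) (1 - 'X^(i.*2.+1)).
Definition tpoly n : {poly F} := cauchy_sum 'X^2 'X n.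

Lemma prod_sqr_qpoly n :
  \prod_(i < n) (1 - ('X^2) ^+ i.+1) = qpoly n * dpoly n.
Proof.
rewrite -big_split /=; apply: eq_bigr => i _.
by rewrite exprAC expr2; ring.
Qed.

(** The finite form of Euler's identity: the odd exponents below 2n and the even ones up to 2n
    together give all exponents from 1 to 2n. *)
Lemma opoly_qpoly n : opoly n * (qpoly n * dpoly n) = qpoly n.*2.
Proof.
rewrite -prod_sqr_qpoly; elim: n => [|n IH].
  by rewrite /opoly /qpoly !big_ord0 mulr1.
rewrite doubleS /qpoly !big_ord_recr /= -/(qpoly _) -IH /opoly big_ord_recr /=.
by rewrite -exprM mul2n doubleS; ring.
Qed.

Lemma qpoly_mod n j : 'X^(n.+1) %| qpoly (n + j) - qpoly n.
Proof.
elim: j => [|j IH]; first by rewrite addn0 subrr dvdp0.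
rewrite addnS /qpoly big_ord_recr /= -/(qpoly (n + j)).
have -> : qpoly (n + j) * (1 - 'X^((n + j).+1)) - qpoly n =
  (qpoly (n + j) - qpoly n) - qpoly (n + j) * 'X^((n + j).+1) by ring.
apply: dvdp_sub => //; apply: dvdp_mull; apply: dvdp_exp2l; lia.
Qed.

(** Iterates [cauchy_sumE] j times from z = X, each step multiplying z by X^2. The boundary terms
    are powers z^(n+1) with z an odd power of X, hence vanish modulo X^(n+1). *)
Lemma opoly_cauchy_sum n j : 'X^(n.+1) %|
  opoly j * tpoly n - cauchy_sum 'X^2 ('X^(j.*2.+1)) n.
Proof.
elim: j => [|j IH].
  by rewrite /opoly big_ord0 mul1r subrr dvdp0.
rewrite /opoly big_ord_recr /= -/(opoly j) doubleS.
have := cauchy_sumE 'X^2 ('X^(j.*2.+1) : {poly F}) n.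
rewrite -exprD add2n => /esym/eqP; rewrite subr_eq => /eqP ->.
set c := cauchy_sum _ _ _ in IH *; set t := tpoly n in IH *.
have -> : opoly j * (1 - 'X^(j.*2.+1)) * t -
   ((1 - 'X^(j.*2.+1)) * c + 'X^(j.*2.+1) ^+ n.+1) =
   (1 - 'X^(j.*2.+1)) * (opoly j * t - c) - 'X^(j.*2.+1) ^+ n.+1 by ring.
apply: dvdp_sub; first exact: dvdp_mull.
rewrite -exprM; apply: dvdp_exp2l; lia.
Qed.

(** The product takes the value 1 at 0. This allows [opoly] and [qpoly] to be cancelled in
    congruences modulo a power of X. *)
Lemma coprimep_Xn_prod (n k : nat) (f : nat -> nat) :
  (forall i, 0 < f i)%N ->
  coprimep 'X^k (\prod_(i < n) (1 - 'X^(f i)) : {poly F}).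
Proof.
move=> f0; apply: coprimep_expl; rewrite coprimep_sym coprimepX /root.
rewrite horner_prod; apply/prodf_neq0 => i _.
by rewrite !hornerE expr0n eqn0Ngt f0 subr0 oner_neq0.
Qed.

Lemma tpoly_mod n : 'X^(n.+1) %| tpoly n - qpoly n * dpoly n ^+ 2.
Proof.
have co : coprimep 'X^(n.+1) (opoly n).
  exact: (@coprimep_Xn_prod _ _ (fun i => i.*2.+1)).
rewrite -(Gauss_dvdpr _ co).
(* After n steps z = X^(2n+1) is itself 0 modulo X^(n+1), so only (X^2; X^2)_n remains of the Cauchy
   sum. *)
have [u hu] := cauchy_sum_mod 'X^2 ('X^(n.*2.+1) : {poly F}) n.
have := opoly_cauchy_sum n n; rewrite {}hu prod_sqr_qpoly.
have := qpoly_mod n n; rewrite addnn -opoly_qpoly => h1 h2.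
have -> : opoly n * (tpoly n - qpoly n * dpoly n ^+ 2) =
  (opoly n * tpoly n - (qpoly n * dpoly n + u * 'X^(n.*2.+1)))
  - dpoly n * (opoly n * (qpoly n * dpoly n) - qpoly n)
  + u * 'X^(n.*2.+1) by ring.
apply: dvdp_add; last by apply/dvdp_mull/dvdp_exp2l; lia.
by apply: dvdp_sub => //; apply: dvdp_mull.
Qed.

(** * Generating functions of the counts, truncated at degree M *)

Definition gno_poly b n M : {poly F} := \poly_(m < M) (gno_count b n m)%:R.

Lemma dvdp_XnP p M : reflect (forall m, (m < M)%N -> p`_m = 0) ('X^M %| p).
Proof.
apply: (iffP idP) => [/dvdpP[r ->] m mM|h].
  by rewrite coefMXn mM.
apply/dvdpP; exists (drop_poly M p); rewrite -[LHS](poly_take_drop M).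
rewrite (_ : take_poly M p = 0) ?add0r//.
by apply/polyP => i; rewrite coef_take_poly coef0; case: ltnP => // /h.
Qed.

Lemma gno_poly0 b M : 'X^M %| gno_poly b 0 M - 1.
Proof.
apply/dvdp_XnP => m mM.
by rewrite coefB coef_poly mM gno_count0 coef1 subrr.
Qed.

Lemma gno_polyS b n M : 'X^M %| gno_poly b n.+1 M - gno_poly b n M -
  'X^(n.+1) * (b%:R * gno_poly true n M + gno_poly false n.+1 M).
Proof.
apply/dvdp_XnP => m mM.
rewrite !coefB coefXnM !coef_poly mM gno_countS natrD ltnS [(m <= n)%N]leqNgt.
case: (ltnP n m) => nm; last first.
  by rewrite mul0n addr0 subrr subr0.
rewrite coefD -polyC_natr coefCM !coef_poly (leq_ltn_trans (leq_subr _ _) mM).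
by rewrite mul1n natrD natrM /=; ring.
Qed.

Lemma qpoly_gno_poly_false n M : 'X^M %| qpoly n * gno_poly false n M - 1.
Proof.
elim: n => [|n IH]; first by rewrite /qpoly big_ord0 mul1r gno_poly0.
rewrite /qpoly big_ord_recr /= -/(qpoly n).
have := gno_polyS false n M; rewrite mul0r add0r => h.
have -> : qpoly n * (1 - 'X^(n.+1)) * gno_poly false n.+1 M - 1 =
  qpoly n * (gno_poly false n.+1 M - gno_poly false n M
     - 'X^(n.+1) * gno_poly false n.+1 M) + (qpoly n * gno_poly false n M - 1).
  by ring.
by apply: dvdp_add => //; apply: dvdp_mull.
Qed.

(** With x = X^(n+1), multiply the recursion for G_(n+1) by (X; X)_(n+1): the G_n terms combine to
    (1 - x)(1 + x) T_n, and (X; X)_(n+1) P_(n+1) is 1. This is the recursion that defines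
    [tpoly]. *)
Lemma qpoly_gno_poly_true n M : 'X^M %| qpoly n * gno_poly true n M - tpoly n.
Proof.
elim: n => [|n IH]; first by rewrite /qpoly big_ord0 mul1r gno_poly0.
have := gno_polyS true n M; rewrite mul1r => h.
have := qpoly_gno_poly_false n.+1 M.
rewrite /qpoly big_ord_recr /= -/(qpoly n) => h'.
rewrite /tpoly /= -/(tpoly n) exprAC.
set x := 'X^(n.+1) in h h' *; set G := gno_poly true n M in h IH *.
set P := gno_poly false _ _ in h h' *.
have -> : qpoly n * (1 - x) * gno_poly true n.+1 M -
   ((1 - x ^+ 2) * tpoly n + x) =
  qpoly n * (1 - x) * (gno_poly true n.+1 M - G - x * (G + P))
  + x * (qpoly n * (1 - x) * P - 1) + (1 - x ^+ 2) * (qpoly n * G - tpoly n).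
  by ring.
by apply: dvdp_add; [apply: dvdp_add|]; apply: dvdp_mull.
Qed.

Lemma gno_poly_mod n : 'X^(n.+1) %| gno_poly true n n.+1 - dpoly n ^+ 2.
Proof.
have co : coprimep 'X^(n.+1) (qpoly n) by exact: (@coprimep_Xn_prod _ _ S).
rewrite -(Gauss_dvdpr _ co).
have -> : qpoly n * (gno_poly true n n.+1 - dpoly n ^+ 2) =
  (qpoly n * gno_poly true n n.+1 - tpoly n)
  + (tpoly n - qpoly n * dpoly n ^+ 2) by ring.
by apply: dvdp_add; rewrite ?tpoly_mod ?qpoly_gno_poly_true.
Qed.

Lemma coef_dpoly_sqr n m : (m <= n)%N ->
  (dpoly n ^+ 2)`_m = (gno_count true m m)%:R.
Proof.
move=> mn; have /dvdp_XnP/(_ m mn) := gno_poly_mod n.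
rewrite coefB coef_poly ltnS mn gno_count_le// => /eqP.
by rewrite subr_eq0 => /eqP <-.
Qed.

End TruncatedIdentity.

(** * Convergence *)

Lemma norm_horner_le (K : numFieldType) (p : {poly K}) (x : K) :
  (forall i, 0 <= p`_i) -> `|p.[x]| <= p.[`|x|].
Proof.
move=> p0; rewrite !horner_coef; apply: le_trans (ler_norm_sum _ _ _) _.
by apply: ler_sum => i _; rewrite normrM normrX ger0_norm.
Qed.

Lemma horner_dpoly (K : numFieldType) (n : nat) (x : K) :
  (dpoly K n).[x] = qpoch (- x) x n.
Proof.
rewrite /qpoch big_mkord horner_prod; apply: eq_bigr => i _.
by rewrite !hornerE mulNr opprK exprS.
Qed.

Lemma coefM_ge0 (K : numFieldType) (p r : {poly K}) :
  (forall i, 0 <= p`_i) -> (forall i, 0 <= r`_i) ->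
  forall i, 0 <= (p * r)`_i.
Proof.
by move=> p0 r0 i; rewrite coefM; apply: sumr_ge0 => j _; exact: mulr_ge0.
Qed.

Lemma coef_dpoly_ge0 (K : numFieldType) (n i : nat) : 0 <= (dpoly K n)`_i.
Proof.
elim: n i => [|n IH] i; first by rewrite /dpoly big_ord0 coef1 ler0n.
rewrite /dpoly big_ord_recr; apply: coefM_ge0 => // j.
by rewrite coefD coef1 coefXn addr_ge0.
Qed.

Lemma coef_dpoly_sqr_ge0 (K : numFieldType) (n i : nat) : 0 <= (dpoly K n ^+ 2)`_i.
Proof. by rewrite expr2; apply: coefM_ge0; exact: coef_dpoly_ge0. Qed.

Lemma coef_dpoly_sqr_le (K : numFieldType) (n m i : nat) : (n <= m)%N ->
  (dpoly K n ^+ 2)`_i <= (dpoly K m ^+ 2)`_i.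
Proof.
move=> /subnK <-; elim: (m - n)%N => [//|k IH]; apply: le_trans IH _.
rewrite addSn /dpoly [in leRHS]big_ord_recr /= -/(dpoly K _).
rewrite -subr_ge0 -coefB.
have -> : (dpoly K (k + n) * (1 + 'X^((k + n).+1))) ^+ 2 - dpoly K (k + n) ^+ 2
  = dpoly K (k + n) ^+ 2 * ('X^((k + n).+1) *+ 2 + 'X^((k + n).+1) ^+ 2) by ring.
apply: coefM_ge0; first exact: coef_dpoly_sqr_ge0.
by move=> j; rewrite -exprM coefD coefMn !coefXn addr_ge0 ?mulrn_wge0.
Qed.

Definition gno_psum (K : numFieldType) (x : K) (n : nat) : K :=
  \sum_(m < n.+1) (gno_count true m m)%:R * x ^+ m.

Definition gno_diag_poly (K : numFieldType) (n : nat) : {poly K} :=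
  \poly_(m < n.+1) (gno_count true m m)%:R.

Lemma horner_gno_diag_poly (K : numFieldType) (n : nat) (x : K) :
  (gno_diag_poly K n).[x] = gno_psum x n.
Proof. by rewrite horner_poly. Qed.

(** Both sides evaluate the same polynomial, whose coefficients vanish up to degree n and are
    nonnegative beyond, so the triangle inequality passes from x to its norm. *)
Lemma gno_psum_approx (K : numFieldType) (x : K) (n : nat) :
  `|qpoch (- x) x n ^+ 2 - gno_psum x n| <=
  qpoch (- `|x|) `|x| n ^+ 2 - gno_psum `|x| n.
Proof.
rewrite -!horner_dpoly -!horner_gno_diag_poly -!horner_exp -!hornerN -!hornerD.
apply: norm_horner_le => i; rewrite coefB coef_poly.
case: ltnP => hi; first by rewrite coef_dpoly_sqr// subrr.
by rewrite subr0 coef_dpoly_sqr_ge0.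
Qed.

Lemma gno_psum_le_qpoch (K : numFieldType) (x : K) (n : nat) : 0 <= x ->
  gno_psum x n <= qpoch (- x) x n ^+ 2.
Proof.
move=> x0; rewrite -subr_ge0.
by have := gno_psum_approx x n; rewrite (ger0_norm x0); exact: le_trans.
Qed.

Lemma qpoch_le_gno_psum (K : numFieldType) (x : K) (n : nat) : 0 <= x ->
  exists m, qpoch (- x) x n ^+ 2 <= gno_psum x m.
Proof.
(* The size makes the partial sum reach every coefficient of [dpoly K n ^+ 2]; the summand n makes
   [dpoly] at the new index dominate [dpoly K n] coefficientwise. *)
move=> x0; exists (n + size (dpoly K n ^+ 2)%R)%N.
set m := (n + _)%N.
rewrite -horner_dpoly -horner_gno_diag_poly -horner_exp -subr_ge0.
rewrite -hornerN -hornerD -[X in _.[X]](ger0_norm x0).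
apply: le_trans (norm_horner_le _ _) => // i; rewrite coefB coef_poly.
case: ltnP => hi.
  by rewrite -(@coef_dpoly_sqr _ m)// subr_ge0 coef_dpoly_sqr_le// leq_addr.
by rewrite nth_default ?subr0// (leq_trans _ (ltnW hi)) ?leq_addl.
Qed.

Lemma gno_psum_homo (K : numFieldType) (x : K) : 0 <= x ->
  {homo gno_psum x : n m / (n <= m)%N >-> n <= m}.
Proof.
move=> x0; apply: homo_leq => // [? ? ?|n]; first exact: le_trans.
by rewrite /gno_psum [leRHS]big_ord_recr /= lerDl mulr_ge0 ?exprn_ge0.
Qed.

(** * Convergence of the infinite product *)

Lemma qpochS (K : numFieldType) (a x : K) (n : nat) :
  qpoch a x n.+1 = qpoch a x n * (1 - a * x ^+ n).
Proof. by rewrite /qpoch big_nat_recr. Qed.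

Lemma qpoch_norm_le (K : numFieldType) (x : K) (n : nat) :
  `|qpoch (- x) x n| <= qpoch (- `|x|) `|x| n.
Proof.
by rewrite -!horner_dpoly; apply: norm_horner_le => i; exact: coef_dpoly_ge0.
Qed.

(** The increment from index i to i + 1 is x^(i+1) times the i-th product, and its norm is at most
    the same increment formed with the norm of x. *)
Lemma qpoch_dist_le (K : numFieldType) (x : K) (n m : nat) : (n <= m)%N ->
  `|qpoch (- x) x m - qpoch (- x) x n| <=
  qpoch (- `|x|) `|x| m - qpoch (- `|x|) `|x| n.
Proof.
move=> /subnK <-; elim: (m - n)%N => [|k IH]; first by rewrite !subrr normr0.
rewrite addSn !qpochS !mulrBr !mulr1 !mulNr !mulrN !opprK.
rewrite -!(addrAC _ (- qpoch _ _ n)).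
apply: le_trans (ler_normD _ _) (lerD IH _).
by rewrite !normrM normrX ler_wpM2r ?mulr_ge0 ?exprn_ge0 ?qpoch_norm_le.
Qed.

(** Each factor 1 + x^(i+1) is at most exp(x^i), and the exponents add up to a partial geometric
    sum. *)
Lemma qpoch_real_bounded (R : realType) (x : R) (n : nat) : 0 <= x < 1 ->
  qpoch (- x) x n <= expR (1 - x)^-1.
Proof.
move=> /andP[x0 x1].
apply: (@le_trans _ _ (expR (\sum_(0 <= i < n) x ^+ i))).
  rewrite expR_sum; apply: ler_prod => i _.
  rewrite mulNr opprK addr_ge0 ?mulr_ge0 ?exprn_ge0//=.
  apply: le_trans (expR_ge1Dx _); rewrite lerD2l.
  by rewrite ler_piMl ?exprn_ge0// ltW.
have x1' : 0 < 1 - x by rewrite subr_gt0.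
rewrite ler_expR -[leRHS]mul1r ler_pdivlMr// big_mkord mulrC -opprB.
by rewrite mulNr -subrX1 opprB lerBlDr lerDl exprn_ge0.
Qed.

(** The domination makes t + u nondecreasing and bounded above, so it converges, and u is its
    difference with t. *)
Lemma cvgn_dominated_real (R : realType) (u t : nat -> R) : cvgn t ->
  (forall n m, (n <= m)%N -> `|u m - u n| <= t m - t n) -> cvgn u.
Proof.
move=> ct h.
have t_homo : {homo t : n m / (n <= m)%N >-> n <= m}.
  by move=> n m /h/(le_trans (normr_ge0 _)); rewrite subr_ge0.
have tu : cvgn (fun n => t n + u n).
  apply: nondecreasing_is_cvgn => [n m /h|].
    by rewrite ler_norml => /andP[+ _]; lra.
  exists (limn t + (limn t - t 0%N + u 0%N)) => _ [n _ <-].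
  have /= := nondecreasing_cvgn_le t_homo ct n.
  by have := h _ _ (leq0n n); rewrite ler_norml => /andP[_]; lra.
have -> : u = (fun n => t n + u n) \- t.
  by apply/funext => n /=; rewrite addrAC subrr add0r.
exact: is_cvgB.
Qed.

Lemma cvgn_real_complex (R : realType) (u : nat -> R) (l : R) :
  u n @[n --> \oo] --> l ->
  ((u n)%:C%C : (R[i] : numFieldType)) @[n --> \oo] -->
  (l%:C%C : (R[i] : numFieldType)).
Proof.
move=> /cvgrPdist_le ul; apply/cvgrPdist_le => e; rewrite ltcE => /andP[/eqP e0 e1].
apply: filterS (ul _ e1) => n; move=> h.
have : `|l%:C%C - (u n)%:C%C : R[i]| <= e.
  by rewrite normc_def lecE e0 /= subrr expr0n addr0 sqrtr_sqr h eqxx.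
exact.
Qed.

Lemma normc_ge_Im (R : rcfType) (x : R[i]) : `|complex.Im x|%:C%C <= `|x|.
Proof.
have := normc_ge_Re (x * 'i%C); rewrite ReiNIm normrN normrM.
by rewrite (normc_def 'i%C) /= expr0n expr1n add0r sqrtr1 mulr1.
Qed.

Lemma cvgn_dominated (R : realType) (u : nat -> (R[i] : numFieldType)) (t : nat -> R) :
  cvgn t ->
  (forall n m, (n <= m)%N -> `|u m - u n| <= (t m - t n)%:C%C) ->
  cvgn u.
Proof.
move=> ct h.
have cre : cvgn (fun n => complex.Re (u n)).
  apply: (cvgn_dominated_real ct) => n m /h; rewrite -lecR -raddfB.
  exact/le_trans/normc_ge_Re.
have cim : cvgn (fun n => complex.Im (u n)).
  apply: (cvgn_dominated_real ct) => n m /h; rewrite -lecR -raddfB.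
  exact/le_trans/normc_ge_Im.
have -> : u = (fun n => (complex.Re (u n))%:C%C + 'i%C * (complex.Im (u n))%:C%C).
  by apply/funext => n; rewrite -complexE.
apply: is_cvgD; first by apply/cvg_ex; eexists; exact: cvgn_real_complex cre.
apply: is_cvgM; first exact: is_cvg_cst.
by apply/cvg_ex; eexists; exact: cvgn_real_complex cim.
Qed.


(** * Finite partial sums over the GNO overpartitions *)

Local Notation gno_overpartition := {lam : overpartition | GNO lam}.

Definition gno_lists (N : nat) : seq (seq part) :=
  [seq s | m <- iota 0 N.+1, s <- gno_enum (m + m).+1 true m m].

Lemma mem_gno_lists (N : nat) (s : seq part) :
  (s \in gno_lists N) =
  [&& is_overpartition s, gno_seq s & (weight_seq s <= N)%N].
Proof.
apply/allpairsPdep/and3P => [[m [s' [+ + ->]]]|[os gs wN]].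
  rewrite mem_iota mem_gno_enum// gno_fromT => /andP[_ mN].
  by move=> /andP[/and3P[-> -> _] /eqP ->].
exists (weight_seq s), s; split => //; first by rewrite mem_iota.
by rewrite mem_gno_enum// gno_fromT os gs all_le_weight_seq eqxx.
Qed.

Lemma gno_lists_uniq (N : nat) : uniq (gno_lists N).
Proof.
apply: allpairs_uniq_dep => [|m _|]; first exact: iota_uniq.
  exact: gno_enum_uniq.
move=> _ _ /allpairsPdep[m [s [_ ms ->]]] /allpairsPdep[m' [s' [_ ms' ->]]] /= ss.
move: ms ms'; rewrite ss !mem_gno_enum// => /andP[_ /eqP <-] /andP[_ /eqP <-].
by [].
Qed.

Lemma sum_gno_lists (K : numFieldType) (x : K) (N : nat) :
  \sum_(s <- gno_lists N) x ^+ weight_seq s = gno_psum x N.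
Proof.
rewrite big_allpairs_dep /gno_psum -(big_mkord xpredT
  (fun m => (gno_count true m m)%:R * x ^+ m)).
apply: eq_bigr => m _; rewrite (eq_big_seq (fun _ => x ^+ m)).
  by rewrite big_const_seq count_predT iter_addr_0 mulr_natl.
by move=> s; rewrite mem_gno_enum// => /andP[_ /eqP ->].
Qed.

(** The index type is a subtype of a subtype of lists, hence two passes of [pmap insub]. These sets
    are cofinal among the finite sets of indices. *)
Definition gno_upto (N : nat) : {fset gno_overpartition} :=
  [fset lam in pmap insub (pmap insub (gno_lists N))]%fset.

Lemma mem_gno_upto (N : nat) (lam : gno_overpartition) :
  (lam \in gno_upto N) = (weight (val lam) <= N)%N.
Proof.
rewrite in_fset [LHS]mem_pmap_sub mem_pmap_sub mem_gno_lists.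
by rewrite (valP (val lam)) (valP lam : gno_seq _).
Qed.

Lemma sum_gno_upto (K : numFieldType) (x : K) (N : nat) :
  \sum_(lam <- gno_upto N) x ^+ weight (val lam) = gno_psum x N.
Proof.
rewrite -sum_gno_lists.
rewrite -(big_map (fun lam : gno_overpartition => parts (val lam)) xpredT
  (fun s => x ^+ weight_seq s)).
apply: perm_big; apply: uniq_perm; rewrite ?gno_lists_uniq//.
  rewrite map_inj_uniq ?fset_uniq// => lam mu h.
  by apply/val_inj/val_inj.
move=> s; rewrite mem_gno_lists; apply/mapP/and3P => [[lam]|[os gs wN]].
  by rewrite mem_gno_upto => ? ->; split => //;
    [exact: (valP (val lam)) | exact: (valP lam)].
by exists (exist _ (exist _ s os) gs); rewrite ?mem_gno_upto.
Qed.

Lemma fsubset_gno_upto (A : {fset gno_overpartition}) :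
  exists N, (A `<=` gno_upto N)%fset.
Proof.
exists (\max_(lam <- A) weight (val lam))%N; apply/fsubsetP => lam lamA.
by rewrite mem_gno_upto (leq_bigmax_seq lam).
Qed.

Lemma sum_fsubset (V : nmodType) (I : choiceType) (f : I -> V)
    (A B : {fset I}) : (A `<=` B)%fset ->
  \sum_(i <- B) f i = \sum_(i <- A) f i + \sum_(i <- (B `\` A)%fset) f i.
Proof.
move=> AB; rewrite -big_cat; apply: perm_big; apply: uniq_perm => //.
  rewrite cat_uniq !fset_uniq andbT; apply/hasPn => i.
  by rewrite inE => /andP[].
move=> i; rewrite mem_cat inE.
by case: (boolP (i \in A)) => [/(fsubsetP AB)|].
Qed.

(** The difference is a sum over elements of A of weight above N. Passing to norms and enlarging A
    to some [gno_upto M] only increases the bound. *)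
Lemma gno_upto_dist (K : numFieldType) (x : K) (N : nat)
    (A : {fset gno_overpartition}) : (gno_upto N `<=` A)%fset ->
  exists M, `|\sum_(lam <- A) x ^+ weight (val lam) - gno_psum x N| <=
    gno_psum `|x| M - gno_psum `|x| N.
Proof.
move=> NA; have [M AM] := fsubset_gno_upto A; exists M.
rewrite -!sum_gno_upto (sum_fsubset _ NA) addrAC subrr add0r.
rewrite (sum_fsubset _ AM) (sum_fsubset _ NA) -[X in _ <= X - _]addrA
  [in leRHS]addrAC subrr add0r.
apply: le_trans (ler_norm_sum _ _ _) _.
under eq_bigr do rewrite normrX.
by rewrite lerDl sumr_ge0.
Qed.

(** * Error bounds at a real argument and passage to the complex one *)

Lemma qpoch_real_homo (R : realType) (x : R) : 0 <= x ->
  {homo qpoch (- x) x : n m / (n <= m)%N >-> n <= m}.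
Proof.
move=> x0 n m /(qpoch_dist_le x); rewrite (ger0_norm x0).
by move=> /(le_trans (normr_ge0 _)); rewrite subr_ge0.
Qed.

Lemma is_cvg_qpoch_real (R : realType) (x : R) : 0 <= x < 1 ->
  cvgn (qpoch (- x) x).
Proof.
move=> x01; apply: nondecreasing_is_cvgn.
  by apply: qpoch_real_homo; case/andP: x01.
by exists (expR (1 - x)^-1) => _ [n _ <-]; exact: qpoch_real_bounded.
Qed.

Lemma gno_psum_cauchy (R : realType) (x e : R) : 0 <= x < 1 -> 0 < e ->
  exists N, forall n, (N <= n)%N ->
    qpoch (- x) x n ^+ 2 - gno_psum x n <= e /\
    forall m, gno_psum x m - gno_psum x n <= e.
Proof.
move=> x01 e0; have /andP[x0 x1] := x01.
have ct := is_cvg_qpoch_real x01.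
set l := limn (qpoch (- x) x).
have t_ge0 n : 0 <= qpoch (- x) x n.
  by have := qpoch_norm_le x n; rewrite (ger0_norm x0); exact: le_trans.
have tl n : qpoch (- x) x n ^+ 2 <= l ^+ 2.
  rewrite ler_sqr ?nnegrE ?(le_trans (t_ge0 n))//;
  exact: nondecreasing_cvgn_le (qpoch_real_homo x0) ct n.
have /cvgrPdist_le /(_ e e0) [N _ hN] :
    qpoch (- x) x n ^+ 2 @[n --> \oo] --> l ^+ 2.
  by rewrite expr2; under eq_cvg do rewrite expr2; exact: cvgM.
have := hN N (leqnn N); rewrite /= ler_norml => /andP[_ lN].
(* From M on, the partial sums are at least the N-th squared product, hence at least l^2 - e; all
   partial sums and all squared products are at most l^2. *)
have [M hM] := qpoch_le_gno_psum N x0.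
exists M => n Mn.
have := gno_psum_homo x0 Mn; have := tl n => h1 h2.
split=> [|m]; first by lra.
by have := gno_psum_le_qpoch m x0; have := tl m; lra.
Qed.

Lemma qpoch_real_complex (R : realType) (x : R) (n : nat) :
  qpoch (- (x%:C%C : R[i])) x%:C%C n = (qpoch (- x) x n)%:C%C.
Proof.
rewrite /qpoch rmorph_prod; apply: eq_bigr => i _.
by rewrite rmorphB rmorph1 rmorphM rmorphN rmorphXn.
Qed.

Lemma gno_psum_real_complex (R : realType) (x : R) (n : nat) :
  gno_psum (x%:C%C : R[i]) n = (gno_psum x n)%:C%C.
Proof.
rewrite /gno_psum rmorph_sum; apply: eq_bigr => i _.
by rewrite rmorphM rmorphXn rmorph_nat.
Qed.

Lemma is_cvg_qpoch_complex (R : realType) (q : R[i]) : `|q| < 1 ->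
  cvgn (qpoch (- q) q).
Proof.
have [r rE] : exists r : R, `|q| = r%:C%C by rewrite normc_def; eexists.
move=> q1; have r01 : 0 <= r < 1 by rewrite -!ltcR -lecR -rE normr_ge0.
apply: (cvgn_dominated (is_cvg_qpoch_real r01)) => n m nm.
by rewrite rmorphB /= -!qpoch_real_complex -rE; exact: qpoch_dist_le.
Qed.

Lemma unordered_sumP (K : numFieldType) (I : choiceType) (f : I -> K) (l : K) :
  (forall e, 0 < e -> exists A : {fset I}, forall B : {fset I},
     (A `<=` B)%fset -> `|l - \sum_(i <- B) f i| <= e) ->
  sum_converges f /\ unordered_sum f = l.
Proof.
move=> h; have FF := @summability.totally_filter I.
have fl : (summability.partial_sum f : {fset I} -> K^o) @ summability.totally
    --> (l : K^o).
  apply/cvgrPdist_le => e /h[A hA]; exists A => // B /hA.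
  by rewrite /summability.partial_sum big_seq_fsetE.
split; first by apply/cvg_ex; exists l.
by apply: cvg_lim => //; exact: norm_hausdorff.
Qed.

(** The error splits into three thirds of e: from the limit to the N-th squared product, from there
    to the partial sum up to weight N, and from there to the sum over a finite set containing
    [gno_upto N]. *)
Lemma unordered_sum_gno (R : realType) (q : R[i]) : `|q| < 1 ->
  sum_converges (fun lam : gno_overpartition => q ^+ weight (val lam)) /\
  unordered_sum (fun lam : gno_overpartition => q ^+ weight (val lam)) =
    qpoch_inf (- q) q ^+ 2.
Proof.
move=> q1; have cq := is_cvg_qpoch_complex q1.
have [r rE] : exists r : R, `|q| = r%:C%C by rewrite normc_def; eexists.
have r01 : 0 <= r < 1 by rewrite -!ltcR -lecR -rE normr_ge0.
have cq2 : qpoch (- q) q n ^+ 2 @[n --> \oo] --> qpoch_inf (- q) q ^+ 2.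
  by rewrite expr2; under eq_cvg do rewrite expr2; exact: cvgM.
apply: unordered_sumP => e e0.
have e3 : 0 < e / 3 by rewrite divr_gt0.
have [N1 _ hN1] := (cvgrPdist_le _ _).1 cq2 _ e3.
have : 0 < complex.Re (e / 3) by move: e3; rewrite ltcE => /andP[].
move=> /(gno_psum_cauchy r01)[N2 hN2].
(* A positive complex number is real, so the bounds obtained in [R] at the norm of q carry over. *)
have e3E : e / 3 = (complex.Re (e / 3))%:C%C by rewrite RRe_real// gtr0_real.
set N := maxn N1 N2.
have [hq hs] := hN2 N (leq_maxr _ _).
exists (gno_upto N) => A /(gno_upto_dist q)[M hM].
have := hN1 N (leq_maxl _ _) => /= h1.
have h2 : `|qpoch (- q) q N ^+ 2 - gno_psum q N| <= e / 3.
  apply: le_trans (gno_psum_approx _ _) _.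
  by rewrite rE qpoch_real_complex gno_psum_real_complex -rmorphXn -rmorphB
    e3E lecR.
have h3 : `|gno_psum q N - \sum_(lam <- A) q ^+ weight (val lam)| <= e / 3.
  rewrite distrC; apply: le_trans hM _.
  by rewrite rE !gno_psum_real_complex -rmorphB e3E lecR.
have -> : e = e / 3 + e / 3 + e / 3 by field.
apply: le_trans (ler_distD (gno_psum q N) _ _) (lerD _ h3).
exact: le_trans (ler_distD (qpoch (- q) q N ^+ 2) _ _) (lerD h1 h2).
Qed.

Theorem mainTheorem5 (R : realType) (q : R[i]) (hq : `|q| < 1) :
  [/\ cvgn (qpoch (- q) q),
      sum_converges (fun lam : {lam : overpartition | GNO lam} =>
        q ^+ weight (val lam))
    & unordered_sum (fun lam : {lam : overpartition | GNO lam} =>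
        q ^+ weight (val lam)) = qpoch_inf (- q) q ^+ 2].
Proof.
have [cvg_sum sumE] := unordered_sum_gno hq.
exact (And3 (is_cvg_qpoch_complex hq) cvg_sum sumE).
Qed.
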